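(* Let $X$ be a complete CAT$(0)$ space, let $r\in\mathbb{N}$, $r\ge2$, and let $\alpha_1,\ldots,\alpha_r\in(0,1)$ with $\sum_{i=1}^r\alpha_i=1$. For $i = 2, \ldots, r$ let $C_i \subseteq X$ be nonempty, closed and convex sets with $\bigcap_{i=2}^r C_i\ne \emptyset$. Define $T_1 : X \to X$, $T_1:=I$, and for $i =2, \ldots, r$ define $T_i : X \to X$ by $T_i := (1-\lambda_i)I +\lambda_i P_i$, where $\lambda_i \in (0,1)$ and $P_i$ is the metric projection of $X$ onto $C_i$. Let $T:X\to X$ be the iterated convex combination of $T_1,\dots,T_r$ with weight $(\alpha_i)_{i=1}^r$ (defined in the context). Then, for all $x \in X$, the Picard iterate $(T^n x)$ $\Delta$-converges to an element of $\bigcap_{i=2}^r C_i$.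
   Context: A CAT$(0)$ space is a geodesic metric space in which every geodesic triangle satisfies the CAT$(0)$ inequality (distances between points on the triangle are at most the distances between corresponding points of a comparison triangle in $\mathbb{R}^2$); it is uniquely geodesic. For $x,y\in X$ and $t\in[0,1]$, $(1-t)x+ty$ is the unique point $z$ of the geodesic segment $[x,y]$ with $d(z,x)=t\,d(x,y)$. A subset is convex if it contains the geodesic segment joining any two of its points. The metric projection onto a nonempty closed convex $Y$ maps $z$ to the unique $y\in Y$ with $d(z,y)=\inf_{u\in Y}d(z,u)$. $I$ is the identity map; convex combinations of maps are taken pointwise. Iterated convex combination: put $a_j=\sum_{i=j}^r\alpha_i$ for $j=1,\ldots,r$; $S_0:=T_r$; if $r\ge3$, for $i=1,\ldots,r-2$, $S_i:=\frac{\alpha_{r-i}}{a_{r-i}}T_{r-i}+\frac{a_{r-i+1}}{a_{r-i}}S_{i-1}$; and $T:=(1-a_2)T_1+a_2S_{r-2}$. For a bounded sequence $(x_n)$ in a metric space $X$, the asymptotic radius is $r((x_n))=\inf\{\limsup_{n}d(x,x_n):x\in X\}$ and the asymptotic center is the set $A((x_n))=\{x\in X:\limsup_n d(x,x_n)=r((x_n))\}$, whose elements are also called asymptotic centers. A bounded sequence $(x_n)$ $\Delta$-converges to $x\in X$ if $x$ is the unique asymptotic center of every subsequence of $(x_n)$. *)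

(* Defs.v *)
From HB Require Import structures.
From mathcomp Require Import all_boot all_order all_algebra.
From mathcomp Require Import all_classical all_reals all_analysis.

Set Implicit Arguments.
Unset Strict Implicit.
Unset Printing Implicit Defensive.

Import Order.TTheory GRing.Theory Num.Theory.
Local Open Scope classical_set_scope.
Local Open Scope ring_scope.

#[short(type="completeMetricType")]
HB.structure Definition CompleteMetric (K : numDomainType) :=
  {T of Metric K T & Complete T}.

Section cat0.
Context {R : realType} {X : metricType R}.
Implicit Types (x y z : X) (c : R -> X) (Y : set X).

(* Only the restriction of c to [0, mdist x y] is constrained. *)
Definition is_geodesic x y c :=
  [/\ c 0 = x, c (mdist x y) = y &
      forall s t, 0 <= s <= mdist x y -> 0 <= t <= mdist x y ->
        mdist (c s) (c t) = `|s - t|].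

(* In general this is the union of all geodesic segments joining x to y; in a
   CAT(0) space there is exactly one, and this is [x, y]. *)
Definition geodesic_segment x y : set X :=
  [set z | exists2 c, is_geodesic x y c &
           exists2 t, 0 <= t <= mdist x y & z = c t].

(* Elements of 'rV_2 carry the sup norm in the library, hence an explicit
   Euclidean distance. *)
Definition eucl_dist (p q : 'rV[R]_2) : R :=
  Num.sqrt (\sum_(k < 2) (p 0 k - q 0 k) ^+ 2).

(* q is the comparison point, on the segment [p1, p2] of the plane, of a point
   at distance t from the first endpoint of the corresponding side. *)
Definition comparison_point (p1 p2 : 'rV[R]_2) (t : R) (q : 'rV[R]_2) :=
  eucl_dist p1 q = t /\
  exists2 s : R, 0 <= s <= 1 & q = (1 - s) *: p1 + s *: p2.

(* A geodesic triangle has vertices v i and sides c i from v i to v (i + 1),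
   indices being taken mod 3. *)
Definition CAT0_triangle (v : 'I_3 -> X) (c : 'I_3 -> R -> X) :=
  forall w : 'I_3 -> 'rV[R]_2,
  (forall i j, eucl_dist (w i) (w j) = mdist (v i) (v j)) ->
  forall (i j : 'I_3) (s t : R) (p q : 'rV[R]_2),
    0 <= s <= mdist (v i) (v (ordS i)) ->
    0 <= t <= mdist (v j) (v (ordS j)) ->
    comparison_point (w i) (w (ordS i)) s p ->
    comparison_point (w j) (w (ordS j)) t q ->
    mdist (c i s) (c j t) <= eucl_dist p q.

Definition geodesically_convex Y :=
  forall x y, Y x -> Y y -> geodesic_segment x y `<=` Y.

(* (1 - t) x + t y, for 0 <= t <= 1: the weight t is that of the second point.
   The default value of xget is irrelevant in a CAT(0) space. *)
Definition geo_comb (t : R) x y : X :=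
  xget x [set z | geodesic_segment x y z /\ mdist z x = t * mdist x y].

(* The default value of xget is irrelevant when Y is nonempty, closed and convex
   in a complete CAT(0) space. *)
Definition metric_proj Y z : X :=
  xget z [set y | Y y /\ mdist z y = inf [set mdist z u | u in Y]].

(* The real-valued limsup and inf below are only meaningful, and only used, for
   bounded sequences. *)
Definition mbounded_seq (u : nat -> X) :=
  exists M : R, forall m n, mdist (u m) (u n) <= M.

Definition asymptotic_radius (u : nat -> X) : R :=
  inf [set limn_sup (fun n => mdist x (u n)) | x in [set: X]].

Definition asymptotic_center (u : nat -> X) : set X :=
  [set x | limn_sup (fun n => mdist x (u n)) = asymptotic_radius u].

Definition Delta_cvg (u : nat -> X) (x : X) :=
  mbounded_seq u /\
  forall phi : nat -> nat, {homo phi : m n / (m < n)%N} ->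
    asymptotic_center (u \o phi) = [set x].

(* Families indexed by 1..r are functions on nat whose values outside that range
   are ignored. *)
Section iterated_comb.
Variables (r : nat) (alpha : nat -> R) (T : nat -> X -> X).

Definition tail_weight (j : nat) : R := \sum_(j <= i < r.+1) alpha i.

(* S_i is a convex combination with weights alpha_(r-i) / a_(r-i) and
   a_(r-i+1) / a_(r-i), which sum to 1. *)
Fixpoint partial_comb (i : nat) : X -> X :=
  if i is k.+1 then
    fun x => geo_comb (tail_weight (r - i).+1 / tail_weight (r - i))
                      (T (r - i)%N x) (partial_comb k x)
  else T r.

Definition iterated_comb : X -> X :=
  fun x => geo_comb (tail_weight 2) (T 1 x) (partial_comb (r - 2) x).

End iterated_comb.
End cat0.

Definition is_CAT0 (R : realType) (X : metricType R) :=
  (forall x y : X, exists c, is_geodesic x y c) /\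
  (forall (v : 'I_3 -> X) (c : 'I_3 -> R -> X),
     (forall i, is_geodesic (v i) (v (ordS i)) (c i)) -> CAT0_triangle v c).

(* Main.v *)
Require Import Defs.
From HB Require Import structures.
From mathcomp Require Import all_boot all_order all_algebra.
From mathcomp Require Import all_classical all_reals all_analysis.
From mathcomp Require Import zify ring lra.
Import Order.TTheory GRing.Theory Num.Theory.
Import numFieldNormedType.Exports.
Local Open Scope classical_set_scope.
Local Open Scope ring_scope.

(** Let F be the intersection of the C_i, let x_n = T^n x, and write d for the
distance.

Comparing a triangle with its comparison triangle in the plane gives the CN
inequality ([CN_inequality]): for z = (1 - t) x + t y and every w,
  d(z,w)^2 <= (1 - t) d(x,w)^2 + t d(y,w)^2 - t (1 - t) d(x,y)^2.
Applied along the segment joining the projection P z of z on a closed convex set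
to a point u of this set, it yields d(z,Pz)^2 + d(Pz,u)^2 <= d(z,u)^2
([metric_projP]).  Hence each relaxed projection satisfies
d(T_i z,u)^2 <= d(z,u)^2 - lambda_i d(z,P_i z)^2 for u in C_i, and by induction
on the iterated combination ([iterated_comb_dist]), for u in F,
  d(Tz,u)^2 <= d(z,u)^2 - sum_(i >= 2) alpha_i lambda_i d(z,P_i z)^2.
So (x_n) is Fejer monotone with respect to F, and d(x_n,P_i x_n) tends to 0 for
every i because the squared distances d(x_n,u)^2 are nonincreasing and bounded
below ([sqr_increment_near0]).

A bounded sequence has exactly one asymptotic center: the function sending y to
the upper limit of d(y,x_n) inherits the midpoint case of the CN inequality,
and such a function has exactly one minimizer on a complete space
([uniformly_convex_minimizer], which also provides metric projections).  If c is
the asymptotic center of a subsequence of (x_n), then P_i c is at least as good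
a center as c, since d(P_i c,y) <= d(c,y) for y = P_i x_n in C_i and y is close
to x_n; by uniqueness c = P_i c, so c lies in F ([asymptotic_center_in]).

Finally, let p be the center of (x_n) and c that of a subsequence.  Both are in
F, so d(x_n,p) and d(x_n,c) converge, and their limits are also their limits
along the subsequence.  As p is at least as good as c for the whole sequence, it
is so for the subsequence, and c = p ([Fejer_Delta_cvg]). *)

(** * Limits of inequalities *)

Lemma ler_scaled_addgt0 (R : realFieldType) (x y C : R) : 0 <= C ->
  (forall e, 0 < e < 1 -> x <= y + e * C) -> x <= y.
Proof.
move=> C0 H; apply/ler_addgt0Pr => e e0.
have C1 : 0 < C + 1 by lra.
have e'0 : 0 < Num.min (1 / 2) (e / (C + 1)).
  by rewrite lt_min divr_gt0 //= divr_gt0.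
have e'1 : Num.min (1 / 2) (e / (C + 1)) < 1.
  by rewrite gt_min; apply/orP; left; lra.
have := H _ (introT andP (conj e'0 e'1)).
have e'2 : Num.min (1 / 2) (e / (C + 1)) <= e / (C + 1).
  by rewrite ge_min lexx orbT.
move: e'0 e'1 e'2; move: (Num.min _ _) => m m0 m1.
rewrite ler_pdivlMr // => m2 h.
nra.
Qed.

(** * The Euclidean plane and comparison triangles *)

Section plane.
Context {R : realType}.
Implicit Types p q : 'rV[R]_2.

Lemma eucl_dist_ge0 p q : 0 <= eucl_dist p q.
Proof. exact: sqrtr_ge0. Qed.

Lemma eucl_dist_sqr p q :
  eucl_dist p q ^+ 2 = (p 0 0 - q 0 0) ^+ 2 + (p 0 1 - q 0 1) ^+ 2.
Proof.
rewrite sqr_sqrtr; last by apply: sumr_ge0 => k _; exact: sqr_ge0.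
rewrite 2!big_ord_recl big_ord0 addr0.
by congr (_ + _); congr ((p _ _ - q _ _) ^+ 2); apply/val_inj.
Qed.

Lemma eucl_dist_eq p q (a : R) : 0 <= a ->
  (p 0 0 - q 0 0) ^+ 2 + (p 0 1 - q 0 1) ^+ 2 = a ^+ 2 -> eucl_dist p q = a.
Proof.
move=> a0 H; apply/eqP; rewrite -(eqrXn2 (n := 2)) ?eucl_dist_ge0 //.
by rewrite eucl_dist_sqr H.
Qed.

Lemma eucl_distC p q : eucl_dist p q = eucl_dist q p.
Proof.
by apply: eucl_dist_eq; [exact: eucl_dist_ge0 | rewrite eucl_dist_sqr; ring].
Qed.

Lemma eucl_distxx p : eucl_dist p p = 0.
Proof. by apply: eucl_dist_eq => //; ring. Qed.

Lemma eucl_dist_comb p q (t : R) : 0 <= t ->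
  eucl_dist p ((1 - t) *: p + t *: q) = t * eucl_dist p q.
Proof.
move=> t0; apply: eucl_dist_eq; first by rewrite mulr_ge0 ?eucl_dist_ge0.
by rewrite exprMn eucl_dist_sqr !mxE; ring.
Qed.

(** Stewart's theorem. *)
Lemma eucl_dist_comb_sqr p q g (t : R) :
  eucl_dist ((1 - t) *: p + t *: q) g ^+ 2 =
  (1 - t) * eucl_dist p g ^+ 2 + t * eucl_dist q g ^+ 2
  - t * (1 - t) * eucl_dist p q ^+ 2.
Proof. by rewrite !eucl_dist_sqr !mxE; ring. Qed.

Lemma comparison_triangle (a b c : R) : 0 <= a -> 0 <= b -> 0 <= c ->
  a <= b + c -> b <= a + c -> c <= a + b ->
  exists p q g : 'rV[R]_2,
    [/\ eucl_dist p q = a, eucl_dist q g = b & eucl_dist p g = c].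
Proof.
move=> a0 b0 c0 abc bac cab.
(* p is the origin and q lies on the first axis *)
pose pt (x y : R) : 'rV[R]_2 := \row_(k < 2) (if k == 0 then x else y).
have [a_eq0|a_neq0] := eqVneq a 0.
  exists 0, 0, (pt c 0); split; apply: eucl_dist_eq => //; rewrite !mxE /=.
  - by rewrite a_eq0; ring.
  - by rewrite (_ : b = c); [ring | lra].
  - by ring.
have a_gt0 : 0 < a by rewrite lt_neqAle eq_sym a_neq0.
pose x := (a ^+ 2 + c ^+ 2 - b ^+ 2) / (2 * a).
have xa : 2 * a * x = a ^+ 2 + c ^+ 2 - b ^+ 2 by rewrite /x; field.
(* Heron: the triangle inequalities make the squared height nonnegative *)
have hx : 0 <= c ^+ 2 - x ^+ 2.
  have h1 : 0 <= (2 * a * c - 2 * a * x) by rewrite xa; nra.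
  have h2 : 0 <= (2 * a * c + 2 * a * x) by rewrite xa; nra.
  have h3 : 0 <= c - x by rewrite -(pmulr_rge0 _ a_gt0); lra.
  have h4 : 0 <= c + x by rewrite -(pmulr_rge0 _ a_gt0); lra.
  by rewrite subr_sqr mulr_ge0.
exists 0, (pt a 0), (pt x (Num.sqrt (c ^+ 2 - x ^+ 2))).
split; apply: eucl_dist_eq => //; rewrite !mxE /=.
- by ring.
- rewrite sub0r sqrrN sqr_sqrtr //.
  have -> : b ^+ 2 = a ^+ 2 + c ^+ 2 - 2 * a * x by rewrite xa; ring.
  by ring.
- by rewrite !sub0r !sqrrN sqr_sqrtr //; ring.
Qed.

End plane.

(** * The CN inequality *)

Section CAT0_geometry.
Context {R : realType} {X : metricType R}.
Hypothesis hX : is_CAT0 X.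
Implicit Types (x y z w : X) (t : R).

Lemma geodesic_segment_dist x y t : 0 <= t <= 1 ->
  exists z, geodesic_segment x y z /\ mdist z x = t * mdist x y.
Proof.
move=> /andP[t0 t1]; have [c cxy] := hX.1 x y; have d0 := mdist_ge0 x y.
have td : 0 <= t * mdist x y <= mdist x y by rewrite mulr_ge0 //= ler_piMl.
exists (c (t * mdist x y)); split.
  by exists c => //; exists (t * mdist x y).
case: cxy => c0 _ ciso; rewrite -{2}c0 ciso ?lexx //.
by rewrite subr0 ger0_norm // mulr_ge0.
Qed.

Lemma geo_combP t x y : 0 <= t <= 1 ->
  geodesic_segment x y (geo_comb t x y) /\
  mdist (geo_comb t x y) x = t * mdist x y.
Proof.
by move=> t01; exact: (xgetPex x (geodesic_segment_dist x y t t01)).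
Qed.

(** Bruhat and Tits' inequality, with an arbitrary weight: the CAT(0) inequality
for z and the vertex w opposite to the side [x, y]. *)
Lemma CN_inequality x y z w t : 0 <= t <= 1 ->
  geodesic_segment x y z -> mdist z x = t * mdist x y ->
  mdist z w ^+ 2 <=
    (1 - t) * mdist x w ^+ 2 + t * mdist y w ^+ 2
    - t * (1 - t) * mdist x y ^+ 2.
Proof.
move=> /andP[t0 t1] [c0 c0g [s s_bnd zE]] dzx.
have d0 := mdist_ge0 x y.
have sE : s = t * mdist x y.
  case: (c0g) => c00 _ ciso.
  rewrite -dzx zE -c00 ciso ?lexx //.
  by rewrite subr0 ger0_norm //; case/andP: s_bnd.
have [c1 c1g] := hX.1 y w; have [c2 c2g] := hX.1 w x.
pose v (i : 'I_3) := if val i is 0%N then x else if val i is 1%N then y else w.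
pose c (i : 'I_3) :=
  if val i is 0%N then c0 else if val i is 1%N then c1 else c2.
have cg i : is_geodesic (v i) (v (ordS i)) (c i).
  by case: i => [[|[|[|]]] ?].
have [p [q [g [dpq dqg dpg]]]] :=
  comparison_triangle _ _ _ (mdist_ge0 x y) (mdist_ge0 y w) (mdist_ge0 x w)
    ltac:(by rewrite addrC (metric_sym y w) metric_triangle)
    ltac:(by rewrite (metric_sym x y) metric_triangle)
    (metric_triangle x y w).
pose W (i : 'I_3) := if val i is 0%N then p else if val i is 1%N then q else g.
have WE i j : eucl_dist (W i) (W j) = mdist (v i) (v j).
  by case: i => [[|[|[|]]] ?]; case: j => [[|[|[|]]] ?] //;
    rewrite /W /v /= ?eucl_distxx ?mdistxx // eucl_distC metric_sym.
(* w is the start of the side joining w to x *)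
pose i0 := @Ordinal 3 0 isT; pose i2 := @Ordinal 3 2 isT.
have := hX.2 v c cg W WE i0 i2 s 0 ((1 - t) *: p + t *: q) g.
have c20 : c i2 0 = w by case: c2g.
rewrite /= c20 /c /= -zE => /(_ s_bnd) H.
have {H} : mdist z w <= eucl_dist ((1 - t) *: p + t *: q) g.
  apply: H; first by rewrite lexx mdist_ge0.
  - split; last by exists t => //; rewrite t0.
    by rewrite /W /= eucl_dist_comb // dpq sE.
  - split; first by rewrite /W /= eucl_distxx.
    by exists 0; rewrite ?lexx ?ler01 // subr0 scale1r scale0r addr0.
rewrite -(@ler_pXn2r _ 2) ?nnegrE ?mdist_ge0 ?eucl_dist_ge0 //.
by rewrite eucl_dist_comb_sqr dpq dqg dpg.
Qed.

Lemma geo_comb_CN x y w t : 0 <= t <= 1 ->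
  mdist (geo_comb t x y) w ^+ 2 <=
    (1 - t) * mdist x w ^+ 2 + t * mdist y w ^+ 2
    - t * (1 - t) * mdist x y ^+ 2.
Proof.
by move=> t01; have [zxy dz] := geo_combP t x y t01; exact: CN_inequality.
Qed.

End CAT0_geometry.

(** * Minimizers of uniformly convex functions *)

Section minimizer.
Context {R : realType} {X : completeMetricType R}.

(** The last hypothesis says that f^2 is uniformly convex at midpoints.  It
makes the diameters of the sublevel sets of f tend to 0 at the infimum, so that
minimizing sequences are Cauchy. *)
Lemma uniformly_convex_minimizer (Y : set X) (f : X -> R) :
  closed Y -> Y !=set0 ->
  (forall x, 0 <= f x) -> (forall x y, f x <= f y + mdist x y) ->
  (forall x y, Y x -> Y y -> exists2 m, Y m &
     f m ^+ 2 <= (f x ^+ 2 + f y ^+ 2) / 2 - mdist x y ^+ 2 / 4) ->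
  exists p, [/\ Y p, f p = inf [set f y | y in Y] &
    forall q, Y q -> f q <= f p -> q = p].
Proof.
move=> Ycl [y0 Yy0] f0 flip fmid.
set I := inf _.
have lbI : lbound [set f y | y in Y] 0 by move=> _ [y _ <-].
have neI : [set f y | y in Y] !=set0 by exists (f y0), y0.
have I0 : 0 <= I by exact: lb_le_inf.
have Ile y : Y y -> I <= f y.
  by move=> Yy; apply: ge_inf; [exists 0 | exists y].
have close x y e : Y x -> Y y -> 0 <= e -> f x <= I + e -> f y <= I + e ->
    mdist x y ^+ 2 <= 4 * (2 * I * e + e ^+ 2).
  move=> Yx Yy e0 fx fy; have [m Ym fm] := fmid x y Yx Yy.
  have fx2 : f x ^+ 2 <= (I + e) ^+ 2 by rewrite ler_pXn2r ?nnegrE //; lra.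
  have fy2 : f y ^+ 2 <= (I + e) ^+ 2 by rewrite ler_pXn2r ?nnegrE //; lra.
  have fm2 : I ^+ 2 <= f m ^+ 2 by rewrite ler_pXn2r ?nnegrE // Ile.
  nra.
have approx n : exists y, Y y /\ f y <= I + n.+1%:R^-1.
  have n0 : 0 < n.+1%:R^-1 :> R by rewrite invr_gt0.
  have [_ [y Yy <-] fy] := inf_adherent n0 (conj neI (ex_intro _ 0 lbI)).
  by exists y; split => //; exact: ltW.
have [u uP] := choice approx.
have ucauchy : cauchy (u @ \oo).
  apply/cauchy_ballP => d d0; near_simpl.
  have e_ex : exists2 e, 0 < e & 4 * (2 * I * e + e ^+ 2) < d ^+ 2.
    (* for e <= 1 the left-hand side is at most 4 (2 I + 1) e *)
    pose k := 4 * (2 * I + 1) + 1.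
    have k0 : 0 < k by rewrite /k; lra.
    have d20 : 0 < d ^+ 2 by rewrite exprn_gt0.
    exists (Num.min 1 (d ^+ 2 / k)).
      by rewrite lt_min ltr01 divr_gt0.
    have m1 : Num.min 1 (d ^+ 2 / k) <= 1 by rewrite ge_min lexx.
    have m2 : Num.min 1 (d ^+ 2 / k) <= d ^+ 2 / k by rewrite ge_min lexx orbT.
    have m0 : 0 < Num.min 1 (d ^+ 2 / k) by rewrite lt_min ltr01 divr_gt0.
    move: m0 m1 m2; move: (Num.min _ _) => m m0 m1.
    rewrite ler_pdivlMr // /k => m2.
    nra.
  have [e e0 ed] := e_ex.
  have : \forall n \near \oo, n.+1%:R^-1 < e :> R.
    exact: near_infty_natSinv_lt (PosNum e0).
  move=> [N _ HN]; near=> n m.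
  have un : (n >= N)%N by near: n; exists N.
  have um : (m >= N)%N by near: m; exists N.
  rewrite ballEmdist /=.
  rewrite -(@ltr_pXn2r _ 2) ?nnegrE ?mdist_ge0 ?(ltW d0) //.
  apply: le_lt_trans ed.
  have [Yn fn] := uP n; have [Ym fm] := uP m.
  have /= {}un := HN n un; have /= {}um := HN m um.
  apply: close => //; first exact: ltW.
    by apply: le_trans fn _; rewrite lerD2l ltW.
  by apply: le_trans fm _; rewrite lerD2l ltW.
have /cvg_ex [p up] : cvg (u @ \oo) by exact/cauchy_cvgP.
have Yp : Y p.
  have uY : \forall n \near \oo, Y (u n) by apply: nearW => n; exact: (uP n).1.
  exact: (@closed_cvg _ _ _ _ u Y Ycl uY p up).
have fp : f p = I.
  apply/eqP; rewrite eq_le Ile // andbT; apply/ler_addgt0Pr => e e0.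
  have e20 : 0 < e / 2 by rewrite divr_gt0.
  have h1 : \forall n \near \oo, n.+1%:R^-1 < e / 2 :> R
    by exact: near_infty_natSinv_lt (PosNum e20).
  have h2 : \forall n \near \oo, mdist p (u n) < e / 2
    by exact: (metricType_numDomainType.cvgr_dist_lt up e20).
  have [n [/= n1 n2]] := @filter_ex _ _ _ _ (filterI h1 h2).
  rewrite (le_trans (flip p (u n))) // (splitr e) addrA lerD ?(ltW n2) //.
  by apply: le_trans (uP n).2 _; rewrite lerD2l ltW.
exists p; split => // q Yq; rewrite fp => fq.
have := close q p 0 Yq Yp (lexx 0); rewrite !addr0 fp => /(_ fq (lexx _)).
rewrite !mulr0 expr0n addr0 mulr0 => d2.
apply: mdist_positivity; apply/eqP; rewrite -sqrf_eq0.
by rewrite eq_le d2 sqr_ge0.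
Unshelve. all: by end_near. Qed.

End minimizer.

(** * Upper limits of bounded sequences *)

Section limsup.
Context {R : realType}.
Variables (u : R^nat) (M : R).
Hypothesis uM : forall n, 0 <= u n <= M.

Let u_ub : has_ubound (range u).
Proof. by exists M => _ [n _ <-]; case/andP: (uM n). Qed.

Let u_lb : has_lbound (range u).
Proof. by exists 0 => _ [n _ <-]; case/andP: (uM n). Qed.

Let le_sups n m : (n <= m)%N -> u m <= sups u n.
Proof.
move=> nm; apply: ub_le_sup; last by exists m.
exact: has_ubound_sdrop.
Qed.

Let limn_supE : limn_sup u = inf (range (sups u)).
Proof. by apply/cvg_lim => //; exact: cvg_sups_inf. Qed.

Let sups_lb : lbound (range (sups u)) 0.
Proof.
move=> _ [n _ <-]; apply: le_trans (le_sups n n (leqnn n)).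
by case/andP: (uM n).
Qed.

Lemma limn_sup_le a : (\forall n \near \oo, u n <= a) -> limn_sup u <= a.
Proof.
move=> [N _ HN]; rewrite limn_supE.
apply: (@le_trans _ _ (sups u N)).
  by apply: ge_inf; [exists 0 | exists N].
apply: ge_sup; first by exists (u N), N => /=.
by move=> _ [n /= Nn <-]; exact: HN.
Qed.

Lemma limn_sup_lt a : limn_sup u < a -> \forall n \near \oo, u n < a.
Proof.
rewrite limn_supE => /inf_lt[]; first by exists (sups u 0%N), 0%N.
move=> _ [N _ <-] supN; exists N => // n /= Nn.
by apply: le_lt_trans supN; exact: le_sups.
Qed.

Lemma limn_sup_ge0 : 0 <= limn_sup u.
Proof.
by rewrite limn_supE; apply: lb_le_inf => //; exists (sups u 0%N), 0%N.
Qed.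

End limsup.

(** * Metric projections *)

Section projection.
Context {R : realType} {X : completeMetricType R}.
Hypothesis hX : is_CAT0 X.
Implicit Types (x y z w : X) (Y : set X).

Lemma CN_midpoint x y w :
  mdist (geo_comb (1 / 2) x y) w ^+ 2 <=
    (mdist x w ^+ 2 + mdist y w ^+ 2) / 2 - mdist x y ^+ 2 / 4.
Proof.
have h : 0 <= (1 / 2 : R) <= 1 by apply/andP; split; lra.
have := geo_comb_CN hX x y w _ h; lra.
Qed.

(** The projection q of z is well defined, and for every u in the set the
triangle z, q, u satisfies the inequality of a right or obtuse angle at q. *)
Lemma metric_projP Y z : Y !=set0 -> closed Y -> geodesically_convex Y ->
  Y (metric_proj Y z) /\
  forall u, Y u ->
    mdist z (metric_proj Y z) ^+ 2 + mdist (metric_proj Y z) u ^+ 2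
      <= mdist z u ^+ 2.
Proof.
move=> Y0 Ycl Yconv.
have [||x y Yx Yy|p [Yp pmin _]] :=
  uniformly_convex_minimizer Y (mdist z) Ycl Y0.
- by move=> x; exact: mdist_ge0.
- by move=> x y; rewrite [mdist x y]metric_sym metric_triangle.
- exists (geo_comb (1 / 2) x y).
    apply: (Yconv x y) => //; apply: (proj1 (geo_combP hX _ x y _)).
    by apply/andP; split; lra.
  by rewrite ![mdist z _]metric_sym; exact: CN_midpoint.
have [] := @xgetPex _ z
  [set y | Y y /\ mdist z y = inf [set mdist z u | u in Y]]
  (ex_intro _ p (conj Yp pmin)).
rewrite -/(metric_proj Y z); move: (metric_proj Y z) => q Yq qmin.
split => // u Yu.
(* compare q with the points of [q, u] close to q, then let them tend to q *)
apply: (@ler_scaled_addgt0 _ _ _ (mdist q u ^+ 2)); first exact: sqr_ge0.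
move=> e /andP[e0 e1].
have e01 : 0 <= e <= 1 by rewrite !ltW.
have [gm _] := geo_combP hX e q u e01.
have := geo_comb_CN hX q u z e e01.
have : mdist z q <= mdist z (geo_comb e q u).
  rewrite qmin; apply: ge_inf; last first.
    by exists (geo_comb e q u) => //; exact: (Yconv q u).
  by exists 0 => _ [y _ <-]; exact: mdist_ge0.
rewrite -(@ler_pXn2r _ 2) ?nnegrE ?mdist_ge0 //.
rewrite ![mdist _ z]metric_sym => h1 h2.
rewrite -(ler_pM2l e0); nra.
Qed.

End projection.

(** * Asymptotic centers *)

Section asymptotic.
Context {R : realType} {X : completeMetricType R}.
Hypothesis hX : is_CAT0 X.
Implicit Types (x y z w : X) (u : nat -> X).

Lemma mbounded_seq_dist u x : mbounded_seq u ->
  exists M, forall n, 0 <= mdist x (u n) <= M.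
Proof.
move=> [M uM]; exists (mdist x (u 0%N) + M) => n.
rewrite mdist_ge0 /=; apply: le_trans (metric_triangle _ (u 0%N) _) _.
by rewrite lerD2l.
Qed.

(** The last clause says that a point at least as good as the center is the
center, which is the form in which uniqueness is used. *)
Lemma asymptotic_center_unique u : mbounded_seq u ->
  exists c, [/\ asymptotic_center u = [set c],
    forall x, limn_sup (fun n => mdist c (u n))
                <= limn_sup (fun n => mdist x (u n)) &
    forall x, limn_sup (fun n => mdist x (u n))
                <= limn_sup (fun n => mdist c (u n)) -> x = c].
Proof.
move=> ub; pose f x := limn_sup (fun n => mdist x (u n)).
have f0 x : 0 <= f x.
  by have [M uM] := mbounded_seq_dist u x ub; exact: limn_sup_ge0 uM.
have flt x a : f x < a -> \forall n \near \oo, mdist x (u n) < a.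
  by have [M uM] := mbounded_seq_dist u x ub; exact: limn_sup_lt uM _.
have fle x a : (\forall n \near \oo, mdist x (u n) <= a) -> f x <= a.
  by have [M uM] := mbounded_seq_dist u x ub; exact: limn_sup_le uM _.
have [||||x y _ _|c [_ cmin cuniq]] := @uniformly_convex_minimizer _ _ setT f.
- exact: closedT.
- by exists (u 0%N).
- exact: f0.
- move=> x y; apply/ler_addgt0Pr => e e0; apply: fle.
  have : f y < f y + e by rewrite ltrDl.
  move/flt; apply: filterS => n yn.
  by have := metric_triangle x y (u n); lra.
- exists (geo_comb (1 / 2) x y) => //.
  apply: (@ler_scaled_addgt0 _ _ _ (f x + f y + 1)).
    by rewrite !addr_ge0.
  move=> e /andP[e0 e1].
  set m := geo_comb _ _ _.
  set K := (_ - _ + _).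
  have near_bound : \forall n \near \oo, mdist m (u n) ^+ 2 <= K.
    have fxe : f x < f x + e by rewrite ltrDl.
    have fye : f y < f y + e by rewrite ltrDl.
    move/flt : fxe => fxe; move/flt : fye => fye.
    apply: filterS2 fxe fye => n xn yn.
    apply: le_trans (CN_midpoint hX x y (u n)) _.
    have xn2 : mdist x (u n) ^+ 2 <= (f x + e) ^+ 2.
      by rewrite ler_pXn2r ?nnegrE ?mdist_ge0 ?ltW // ltr_wpDl.
    have yn2 : mdist y (u n) ^+ 2 <= (f y + e) ^+ 2.
      by rewrite ler_pXn2r ?nnegrE ?mdist_ge0 ?ltW // ltr_wpDl.
    have ee : e ^+ 2 <= e by rewrite expr2 ler_piMl // ltW.
    rewrite /K; nra.
  have K0 : 0 <= K.
    have [n nK] := @filter_ex _ _ _ _ near_bound.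
    by apply: le_trans nK; exact: sqr_ge0.
  have fm : f m <= Num.sqrt K.
    apply: fle; apply: filterS near_bound => n nK.
    by rewrite -(ger0_norm (mdist_ge0 m (u n))) -sqrtr_sqr ler_sqrt.
  by rewrite -(sqr_sqrtr K0) ler_pXn2r ?nnegrE ?sqrtr_ge0.
exists c; split; last by move=> x; exact: cuniq.
  apply/seteqP; split => [x|x ->] //=.
  rewrite /asymptotic_center /asymptotic_radius /=.
  by rewrite -/(f _) -cmin => xc; apply: cuniq => //; rewrite xc.
move=> x; rewrite -/(f c) -/(f x) cmin; apply: ge_inf; last by exists x.
by exists 0 => _ [y _ <-]; exact: f0.
Qed.

End asymptotic.

(** * Fejer monotone sequences *)

(** The sum of the k e_n^2 telescopes below D_0, hence e_n tends to 0. *)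
Lemma sqr_increment_near0 (R : realType) (D e : R^nat) (k : R) : 0 < k ->
  (forall n, 0 <= D n) -> (forall n, 0 <= e n) ->
  (forall n, D n.+1 <= D n - k * e n ^+ 2) ->
  forall eps, 0 < eps -> \forall n \near \oo, e n < eps.
Proof.
move=> k0 D0 e0 De eps eps0.
have Dni : nonincreasing_seq D.
  apply/nonincreasing_seqP => n; apply: le_trans (De n) _.
  by rewrite gerBl mulr_ge0 ?sqr_ge0 ?ltW.
have lbD : has_lbound (range D) by exists 0 => _ [n _ <-].
have keps : 0 < k * eps ^+ 2 by rewrite mulr_gt0 ?exprn_gt0.
have neD : range D !=set0 by exists (D 0%N), 0%N.
have [_ [N _ <-] DN] := inf_adherent keps (conj neD lbD).
exists N => // n /= Nn.
have DnN : D n <= D N by exact: Dni.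
have Dn1 : inf (range D) <= D n.+1 by apply: ge_inf => //; exists n.+1.
rewrite -(@ltr_pXn2r _ 2) ?nnegrE ?(ltW eps0) // -(ltr_pM2l k0).
have := De n; lra.
Qed.

Lemma homo_ltn_leq_self (phi : nat -> nat) :
  {homo phi : m n / (m < n)%N} -> forall n, (n <= phi n)%N.
Proof.
move=> hphi; elim=> // n IH; apply: leq_ltn_trans IH _.
exact: hphi.
Qed.

Lemma near_subseq (phi : nat -> nat) (P : nat -> Prop) :
  {homo phi : m n / (m < n)%N} ->
  (\forall n \near \oo, P n) -> \forall n \near \oo, P (phi n).
Proof.
move=> hphi [N _ HN]; exists N => // n /= Nn; apply: HN => /=.
exact: leq_trans Nn (homo_ltn_leq_self _ hphi n).
Qed.

Section Fejer.
Context {R : realType} {X : completeMetricType R}.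
Hypothesis hX : is_CAT0 X.
Implicit Types (x : nat -> X) (c p : X) (F : set X).

(** The distances to c decrease to a limit, which every subsequence shares. *)
Lemma limn_sup_dist_Fejer x c (phi : nat -> nat) :
  (forall n, mdist c (x n.+1) <= mdist c (x n)) ->
  {homo phi : m n / (m < n)%N} ->
  limn_sup (fun n => mdist c (x (phi n))) =
  inf (range (fun n => mdist c (x n))).
Proof.
move=> xc hphi.
have cvg_d : (fun n => mdist c (x n)) @ \oo -->
    inf (range (fun n => mdist c (x n))).
  apply: nonincreasing_cvgn; first exact/nonincreasing_seqP.
  by exists 0 => _ [n _ <-]; exact: mdist_ge0.
apply: (cvg_limn_inf_sup _).2.
have phioo : phi n @[n --> \oo] --> \oo.
  by move=> P; exact: near_subseq.
exact: cvg_comp phioo cvg_d.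
Qed.

(** A sequence that is Fejer monotone with respect to F Delta-converges to a
point of F as soon as the asymptotic centers of its subsequences lie in F. *)
Lemma Fejer_Delta_cvg x F : F !=set0 ->
  (forall u, F u -> forall n, mdist u (x n.+1) <= mdist u (x n)) ->
  (forall phi : nat -> nat, {homo phi : m n / (m < n)%N} ->
     forall c, asymptotic_center (x \o phi) = [set c] -> F c) ->
  exists2 p, F p & Delta_cvg x p.
Proof.
move=> [u Fu] xF centerF.
have xb : mbounded_seq x.
  have dec n : mdist u (x n) <= mdist u (x 0%N).
    by elim: n => // n; apply: le_trans; exact: xF.
  exists (mdist u (x 0%N) + mdist u (x 0%N)) => m n.
  apply: le_trans (metric_triangle _ u _) _.
  by rewrite lerD // metric_sym.
have xphib (phi : nat -> nat) : mbounded_seq (x \o phi).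
  by have [M xM] := xb; exists M => m n; exact: xM.
have [p [pE pmin _]] := asymptotic_center_unique hX x xb.
have Fp : F p by exact: (centerF id).
exists p => //; split => // phi hphi.
have [c [cE _ cuniq]] := asymptotic_center_unique hX _ (xphib phi).
have Fc : F c by exact: (centerF phi).
rewrite cE; congr [set _]; apply/esym/cuniq => /=.
(* along phi as along the whole sequence, the distances to p and to c have the
   same limits *)
rewrite !(limn_sup_dist_Fejer _ _ phi) //; [|exact: xF..].
have := pmin c.
by rewrite !(limn_sup_dist_Fejer _ _ id) //; exact: xF.
Qed.

(** Demiclosedness of the projection. *)
Lemma asymptotic_center_in Y (x : nat -> X) c :
  Y !=set0 -> closed Y -> geodesically_convex Y ->
  mbounded_seq x ->
  (forall e, 0 < e ->
     \forall n \near \oo, mdist (x n) (metric_proj Y (x n)) < e) ->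
  asymptotic_center x = [set c] -> Y c.
Proof.
move=> Y0 Ycl Yconv xb xY cE.
have [Yc projc] := metric_projP hX Y c Y0 Ycl Yconv.
have [c' [c'E _ c'uniq]] := asymptotic_center_unique hX x xb.
have c'c : c' = c by have : [set c] c' by rewrite -cE c'E.
rewrite {}c'c {c' c'E} in c'uniq.
rewrite -(c'uniq (metric_proj Y c)) //.
apply/ler_addgt0Pr => e e0.
have [M xM] := mbounded_seq_dist x c xb.
have [M' xM'] := mbounded_seq_dist x (metric_proj Y c) xb.
apply: (limn_sup_le _ M') => //.
set l := limn_sup _.
have e30 : 0 < e / 3 by rewrite divr_gt0.
have ltl : l < l + e / 3 by rewrite ltrDl.
have := limn_sup_lt _ M xM _ ltl; have := xY _ e30.
apply: filterS2 => n h1 h2.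
have [Yn _] := metric_projP hX Y (x n) Y0 Ycl Yconv.
move: h1 Yn; move: (metric_proj Y (x n)) => y h1 Yy.
have h3 : mdist (metric_proj Y c) y <= mdist c y.
  rewrite -(@ler_pXn2r _ 2) ?nnegrE ?mdist_ge0 //.
  by apply: le_trans (projc y Yy); rewrite lerDr sqr_ge0.
have h4 := metric_triangle (metric_proj Y c) y (x n).
have h5 := metric_triangle c (x n) y.
rewrite [mdist y _]metric_sym in h4.
lra.
Qed.

Lemma relaxed_proj_dist Y (l : R) (z u : X) :
  Y !=set0 -> closed Y -> geodesically_convex Y -> 0 <= l <= 1 -> Y u ->
  mdist (geo_comb l z (metric_proj Y z)) u ^+ 2 <=
    mdist z u ^+ 2 - l * mdist z (metric_proj Y z) ^+ 2.
Proof.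
move=> Y0 Ycl Yconv l01 Yu.
have [_ /(_ u Yu) pu] := metric_projP hX Y z Y0 Ycl Yconv.
have := geo_comb_CN hX z (metric_proj Y z) u l l01.
move: l01 => /andP[l0 l1].
have := sqr_ge0 (mdist z (metric_proj Y z)).
move: pu; move: (mdist z _ ^+ 2) (mdist _ u ^+ 2) (mdist z u ^+ 2) => P Q Z pu.
move=> P0 h; apply: le_trans h _.
have lP : 0 <= l * (1 - l) * P by rewrite !mulr_ge0 // subr_ge0.
have := ler_wpM2l l0 pu; lra.
Qed.

End Fejer.

(** * Iterated convex combinations *)

Section iterated.
Context {R : realType} {X : completeMetricType R}.
Hypothesis hX : is_CAT0 X.
Variables (r : nat) (alpha : nat -> R) (T : nat -> X -> X).
Hypothesis hr : (2 <= r)%N.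
Hypothesis halpha : forall i : nat, (1 <= i <= r)%N -> 0 < alpha i.

Let tail_weight_recl j : (j <= r)%N ->
  tail_weight r alpha j = alpha j + tail_weight r alpha j.+1.
Proof. by move=> jr; rewrite /tail_weight big_ltn. Qed.

Let tail_weight_ge0 j : (1 <= j)%N -> 0 <= tail_weight r alpha j.
Proof.
move=> j1; rewrite /tail_weight big_nat_cond; apply: sumr_ge0 => i.
move=> /andP[/andP[ji ir] _]; apply/ltW/halpha.
by rewrite (leq_trans j1 ji).
Qed.

Let tail_weight_gt0 j : (1 <= j <= r)%N -> 0 < tail_weight r alpha j.
Proof.
move=> /andP[j1 jr]; rewrite tail_weight_recl // ltr_pwDl ?tail_weight_ge0 //.
by apply: halpha; rewrite j1.
Qed.

Variables (z u : X) (beta : nat -> R).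
Hypothesis hT : forall i, (2 <= i <= r)%N ->
  mdist (T i z) u ^+ 2 <= mdist z u ^+ 2 - beta i.

(** The inequality is multiplied by the total weight of T_(r-k), ..., T_r, which
clears the denominators of the weights of the combination. *)
Lemma partial_comb_dist k : (k <= r - 2)%N ->
  tail_weight r alpha (r - k) * mdist (partial_comb r alpha T k z) u ^+ 2 <=
  tail_weight r alpha (r - k) * mdist z u ^+ 2
  - \sum_(r - k <= i < r.+1) alpha i * beta i.
Proof.
elim: k => [_|k IH kr].
  rewrite subn0 /= /tail_weight !big_nat1 -mulrBr ler_pM2l ?hT ?hr ?leqnn //.
  by apply: halpha; rewrite leqnn (leq_trans _ hr).
have rk : (r - k = (r - k.+1).+1)%N by rewrite subnSK //; lia.
have {IH} := IH (ltnW kr); rewrite rk /=.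
have jr : (2 <= r - k.+1 <= r)%N by lia.
move: (r - k.+1)%N jr => j /andP[j2 jr] IH.
rewrite (tail_weight_recl j) // [in X in _ <= X](big_ltn (m := j)) //.
have aj : 0 < alpha j by apply: halpha; rewrite jr (leq_trans _ j2).
have b0 := tail_weight_ge0 j.+1 isT.
set b := tail_weight r alpha j.+1 in IH b0 *.
have t01 : 0 <= b / (alpha j + b) <= 1.
  have ab : 0 < alpha j + b by rewrite ltr_pwDl.
  by rewrite divr_ge0 ?(ltW ab) //= ler_pdivrMr // mul1r lerDr ltW.
have := geo_comb_CN hX (T j z) (partial_comb r alpha T k z) u _ t01.
have := hT j; rewrite j2 jr => /(_ isT).
move: (geo_comb _ _ _) => y.
set A := mdist (T j z) u ^+ 2.
set B := mdist (partial_comb _ _ _ _ _) u ^+ 2 in IH *.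
set D := mdist (T j z) _ ^+ 2; set Z := mdist z u ^+ 2 in IH *.
have D0 : 0 <= D by exact: sqr_ge0.
have ab : 0 < alpha j + b by rewrite ltr_pwDl.
set S := \sum_(_ <= _ < _) _ in IH *.
move=> hA; set t := b / (alpha j + b) in t01 * => hy.
have tE : (alpha j + b) * t = b by rewrite /t mulrC divfK // gt_eqF.
have hy' : (alpha j + b) * mdist y u ^+ 2 <=
    (alpha j + b) * ((1 - t) * A + t * B).
  rewrite ler_pM2l //; apply: le_trans hy _; rewrite gerBl mulr_ge0 //.
  by case/andP: t01 => ? ?; rewrite mulr_ge0 // subr_ge0.
have e1 : (alpha j + b) * ((1 - t) * A + t * B) = alpha j * A + b * B.
  clearbody t A B.
  transitivity ((alpha j + b - (alpha j + b) * t) * A + (alpha j + b) * t * B).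
    by ring.
  by rewrite tE; ring.
have hA' : alpha j * A <= alpha j * (Z - beta j) by rewrite ler_pM2l.
rewrite e1 in hy'; lra.
Qed.

Lemma iterated_comb_dist : T 1 z = z -> \sum_(1 <= i < r.+1) alpha i = 1 ->
  mdist (iterated_comb r alpha T z) u ^+ 2 <=
  mdist z u ^+ 2 - \sum_(2 <= i < r.+1) alpha i * beta i.
Proof.
move=> T1 hsum.
have a2 : alpha 1%N + tail_weight r alpha 2 = 1.
  by rewrite -tail_weight_recl // (leq_trans _ hr).
have a20 := tail_weight_ge0 2 isT.
have a1 : 0 < alpha 1%N by apply: halpha; rewrite /= (leq_trans _ hr).
have t01 : 0 <= tail_weight r alpha 2 <= 1 by rewrite a20 -a2 lerDr ltW.
have := partial_comb_dist (r - 2) (leqnn _); rewrite subKn // => h.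
have := geo_comb_CN hX (T 1%N z) (partial_comb r alpha T (r - 2) z) u _ t01.
rewrite -/(iterated_comb r alpha T z) T1.
set D := mdist z (partial_comb _ _ _ _ _) ^+ 2 => hc.
have D0 : 0 <= D by exact: sqr_ge0.
have : 0 <= tail_weight r alpha 2 * (1 - tail_weight r alpha 2) * D.
  by case/andP: t01 => ? ?; rewrite mulr_ge0 // mulr_ge0 // subr_ge0.
lra.
Qed.

End iterated.

(** * Picard iterates of relaxed projections *)

Theorem corollary5p6 (R : realType) (X : completeMetricType R)
    (hX : is_CAT0 X)
    (r : nat) (hr : (2 <= r)%N)
    (alpha : nat -> R)
    (halpha : forall i : nat, (1 <= i <= r)%N -> 0 < alpha i < 1)
    (hsum : \sum_(1 <= i < r.+1) alpha i = 1)
    (C : nat -> set X)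
    (hC : forall i : nat, (2 <= i <= r)%N ->
      [/\ C i !=set0, closed (C i) & geodesically_convex (C i)])
    (hCI : \bigcap_(i in [set i : nat | (2 <= i <= r)%N]) C i !=set0)
    (lambda : nat -> R)
    (hlambda : forall i : nat, (2 <= i <= r)%N -> 0 < lambda i < 1)
    (T : nat -> X -> X)
    (hT1 : forall x : X, T 1%N x = x)
    (hT : forall i : nat, (2 <= i <= r)%N ->
      forall x : X, T i x = geo_comb (lambda i) x (metric_proj (C i) x))
    (x : X) :
  exists2 p : X, (\bigcap_(i in [set i : nat | (2 <= i <= r)%N]) C i) p &
    Delta_cvg (fun n : nat => iter n (iterated_comb r alpha T) x) p.
Proof.
have alpha_gt0 i : (1 <= i <= r)%N -> 0 < alpha i by move/halpha/andP => [].
(* by this amount at least, T i decreases the squared distances from z to the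
   points of C i *)
pose res i z := lambda i * mdist z (metric_proj (C i) z) ^+ 2.
have step u z : (\bigcap_(i in [set i : nat | (2 <= i <= r)%N]) C i) u ->
    mdist (iterated_comb r alpha T z) u ^+ 2 <=
    mdist z u ^+ 2 - \sum_(2 <= i < r.+1) alpha i * res i z.
  move=> Fu; apply: iterated_comb_dist => // i ir; rewrite hT //.
  have [Ci0 Cicl Cicv] := hC i ir.
  apply: relaxed_proj_dist => //; last exact: Fu.
  by have /andP[l0 l1] := hlambda i ir; rewrite !ltW.
have res_ge0 i z : (2 <= i <= r)%N -> 0 <= alpha i * res i z.
  move=> ir; have /andP[l0 _] := hlambda i ir.
  have a0 : 0 < alpha i.
    by apply: alpha_gt0; case/andP: ir => i2 ->; rewrite (leq_trans _ i2).
  by rewrite /res mulr_ge0 ?(ltW a0) // mulr_ge0 ?(ltW l0) // sqr_ge0.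
have step1 i u z : (\bigcap_(i in [set i : nat | (2 <= i <= r)%N]) C i) u ->
    (2 <= i <= r)%N ->
    mdist (iterated_comb r alpha T z) u ^+ 2 <=
    mdist z u ^+ 2 - alpha i * res i z.
  move=> Fu ir; apply: le_trans (step u z Fu) _; rewrite lerD2l lerN2.
  (* all terms of the sum are nonnegative, and the i-th one is kept *)
  rewrite (bigD1_seq i) /= ?iota_uniq ?mem_index_iota //.
  rewrite lerDl big_nat_cond big_mkcondr /=.
  rewrite big_nat_cond; apply: sumr_ge0 => j /andP[jr _].
  by case: ifP => // _; exact: res_ge0.
pose s n := iter n (iterated_comb r alpha T) x.
have s_dec u : (\bigcap_(i in [set i : nat | (2 <= i <= r)%N]) C i) u ->
    forall n, mdist u (s n.+1) <= mdist u (s n).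
  move=> Fu n; rewrite -(@ler_pXn2r _ 2) ?nnegrE ?mdist_ge0 //.
  rewrite ![mdist u _]metric_sym /=.
  have r2 : (2 <= 2 <= r)%N by rewrite hr.
  apply: le_trans (step1 2 u (s n) Fu r2) _.
  by rewrite gerBl res_ge0.
have [u0 Fu0] := hCI.
apply: (Fejer_Delta_cvg hX s) => // phi hphi c cE i /= ir.
have [Ci0 Cicl Cicv] := hC i ir.
apply: (asymptotic_center_in hX (C i) (s \o phi)) => //.
  exists (mdist u0 x + mdist u0 x) => m n /=.
  have dec k : mdist u0 (s k) <= mdist u0 x.
    by elim: k => // k; apply: le_trans; exact: s_dec.
  by apply: le_trans (metric_triangle _ u0 _) _; rewrite lerD // metric_sym.
move=> e e0.
apply: (near_subseq phi
  (fun n => mdist (s n) (metric_proj (C i) (s n)) < e)) => //.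
apply: (@sqr_increment_near0 _ (fun n => mdist (s n) u0 ^+ 2) _
  (alpha i * lambda i)) => //.
- have /andP[l0 _] := hlambda i ir; rewrite mulr_gt0 // alpha_gt0 //.
  by case/andP: ir => i2 ->; rewrite (leq_trans _ i2).
- by move=> n; exact: sqr_ge0.
- by move=> n; rewrite mdist_ge0.
- by move=> n; rewrite -mulrA; exact: step1.
Qed.
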